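(* Let $m,l,t$ be positive integers with $m\ge tl$, let $\mathcal G\subset\binom{[m]}l$ be a family, and let $\alpha:=|\mathcal G|/\binom ml$. Let $\mathcal B$ be chosen uniformly at random among all $t$-tuples of pairwise disjoint $l$-element subsets of $[m]$, and let $\eta:=|\mathcal G\cap\mathcal B|$ be the number of sets in $\mathcal B$ that belong to $\mathcal G$. Then $\mathrm E[\eta]=\alpha t$ and, for any positive $\beta$, $$\Pr\big[|\eta-\alpha t|\ge\beta t\big]\le\frac{2\alpha(1-\alpha)}{\beta^2t}.$$
   Context: $[m]=\{1,\dots,m\}$ and $\binom{[m]}l$ is the family of all $l$-element subsets of $[m]$. *)

(* Defs.v *)
From mathcomp Require Import all_boot all_order all_algebra.

Set Implicit Arguments.
Unset Strict Implicit.
Unset Printing Implicit Defensive.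

Import Order.TTheory GRing.Theory Num.Theory.

Local Open Scope ring_scope.

(* Expectation and probability for the uniform distribution on a finite set
   [Omega], which has to be nonempty for these to be meaningful. *)
Definition unifE (R : realFieldType) (T : finType) (Omega : {set T})
    (X : T -> R) : R :=
  (\sum_(w in Omega) X w) / #|Omega|%:R.

Definition unifPr (R : realFieldType) (T : finType) (Omega : {set T})
    (P : pred T) : R :=
  #|[set w in Omega | P w]|%:R / #|Omega|%:R.

(* The ground set [m] = {1, ..., m} is represented by 'I_m = {0, ..., m - 1}. *)
Definition lsubsets (m l : nat) : {set {set 'I_m}} :=
  [set A : {set 'I_m} | #|A| == l].

Definition disjoint_tuples (m l t : nat) : {set t.-tuple {set 'I_m}} :=
  [set B : t.-tuple {set 'I_m} |
    [forall i, tnth B i \in lsubsets m l] &&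
    [forall i, forall j, (i != j) ==> [disjoint tnth B i & tnth B j]]].

Definition density (R : realFieldType) (m l : nat) (G : {set {set 'I_m}}) : R :=
  #|G|%:R / 'C(m, l)%:R.

(* The components of a tuple of pairwise disjoint nonempty sets are distinct, so
   passing to the underlying set of components loses no multiplicity. *)
Definition eta (m t : nat) (G : {set {set 'I_m}})
    (B : t.-tuple {set 'I_m}) : nat :=
  #|G :&: [set A in B]|.

(* Main.v *)
(* Write h for the centred indicator of G. The variance of eta is a sum over
   pairs (i, j) of the mean of h(B_i) h(B_j); by symmetry the off-diagonal terms
   are means over uniform disjoint pairs of l-sets, that is, quadratic forms of
   the adjacency operator K of the Kneser graph, and it suffices that
   <h, K h> <= k <h, h> for sum-zero h, where k = C(m-l-1, l-1) satisfies
   (t-1) k <= C(m-l, l).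

   This spectral bound needs no knowledge of the eigenvalues. Exchanging two
   points x in A, y outside A changes K f only through the B that contain y, so
   K multiplies the Lipschitz constant for exchanges by at most k. Hence the
   iterates of K on a sum-zero function are O(k^n), and since |K^n f|^2 is
   log-convex in n (K is symmetric), this forces |K f| <= k |f|. *)
Require Import Defs.
From mathcomp Require Import all_boot all_order all_algebra.
From mathcomp Require Import perm archimedean zify ring lra.

Set Implicit Arguments.
Unset Strict Implicit.
Unset Printing Implicit Defensive.

Import Order.TTheory GRing.Theory Num.Theory.

Local Open Scope ring_scope.

(** * Log-convexity and quadratic forms of symmetric operators *)

(** Lagrange's identity: twice the defect is the sum of [(f x * g y - f y * g x) ^+ 2] over all
    pairs. *)
Lemma sum_Cauchy_Schwarz (R : realFieldType) (T : finType) (O : {set T})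
    (f g : T -> R) :
  (\sum_(x in O) f x * g x) ^+ 2 <=
  (\sum_(x in O) f x ^+ 2) * (\sum_(x in O) g x ^+ 2).
Proof.
set a := \sum_(x in O) f x ^+ 2; set b := \sum_(x in O) g x ^+ 2.
set c := \sum_(x in O) _.
have sumE : \sum_(x in O) \sum_(y in O) (f x * g y - f y * g x) ^+ 2 =
            2 * (a * b - c ^+ 2).
  transitivity (\sum_(x in O) (f x ^+ 2 * b + a * g x ^+ 2
                               - 2 * (f x * g x) * c)).
    apply: eq_bigr => x _; rewrite /a /b /c mulr_suml !mulr_sumr -big_split /=.
    by rewrite -sumrB; apply: eq_bigr => y _; ring.
  rewrite sumrB big_split /= -mulr_suml -!mulr_sumr -mulr_suml -mulr_sumr.
  rewrite -/a -/b -/c; ring.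
have : 0 <= 2 * (a * b - c ^+ 2).
  by rewrite -sumE; do 2!apply: sumr_ge0 => ? _; apply: sqr_ge0.
by rewrite pmulr_rge0 // subr_ge0.
Qed.

Lemma bernoulli_ineq (R : realFieldType) (s : R) (n : nat) :
  1 <= s -> 1 + n%:R * (s - 1) <= s ^+ n.
Proof.
move=> s1; elim: n => [|n IHn]; first by rewrite mul0r addr0 expr0.
rewrite exprS; apply: le_trans (ler_wpM2l _ IHn); last by lra.
rewrite -natr1; have : 0 <= n%:R * (s - 1) ^+ 2 by rewrite mulr_ge0 ?sqr_ge0.
nra.
Qed.

(** Log-convexity makes the ratios [b n.+1 / b n] nondecreasing. If the first one exceeded [q], then
    [b] would outgrow [C * q ^+ n], by Bernoulli's inequality and the archimedean property. *)
Lemma log_convex_growth (R : archiRealFieldType) (b : nat -> R) (C q : R) :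
  (forall n, 0 <= b n) -> (forall n, b n.+1 ^+ 2 <= b n * b n.+2) ->
  0 < q -> (forall n, b n <= C * q ^+ n) -> b 1%N <= q * b 0%N.
Proof.
move=> b_ge0 b_cvx q_gt0 b_le; rewrite leNgt; apply/negP => lt_b1.
have b1_gt0 : 0 < b 1%N by apply: le_lt_trans lt_b1; rewrite mulr_ge0 // ltW.
have b0_gt0 : 0 < b 0%N.
  rewrite lt_def b_ge0 andbT; apply: contraTneq (b_cvx 0%N) => ->.
  by rewrite mul0r -ltNge exprn_gt0.
have ratio n : (0 < b n) /\ (b n * b 1%N <= b n.+1 * b 0%N).
  elim: n => [|n [bn_gt0 IHn]]; first by rewrite mulrC.
  have bS_gt0 : 0 < b n.+1.
    by rewrite -(pmulr_lgt0 _ b0_gt0); apply: lt_le_trans IHn; rewrite mulr_gt0.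
  (* The ratio comparison is cross-multiplied; a factor [b n] is inserted so that log-convexity
     applies. *)
  split=> //; rewrite -(ler_pM2l bn_gt0).
  apply: (@le_trans _ _ (b n.+1 ^+ 2 * b 0%N)).
    by rewrite mulrCA expr2 -mulrA ler_pM2l.
  by rewrite mulrA ler_pM2r.
pose s := b 1%N / (q * b 0%N).
have s_gt1 : 1 < s by rewrite ltr_pdivlMr ?mulr_gt0 // mul1r.
have geom n : (q * s) ^+ n * b 0%N <= b n.
  have qsE : q * s = b 1%N / b 0%N by rewrite /s; field; rewrite !gt_eqF.
  elim: n => [|n IHn]; first by rewrite mul1r.
  rewrite exprS -mulrA (le_trans (ler_wpM2l _ IHn)) //.
    by rewrite qsE divr_ge0 // ltW.
  by rewrite qsE mulrAC ler_pdivrMr // mulrC; case: (ratio n).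
have bound n : s ^+ n <= C / b 0%N.
  rewrite ler_pdivlMr // -(ler_pM2l (exprn_gt0 n q_gt0)) mulrA -exprMn.
  by rewrite (le_trans (geom n)) // mulrC.
have C_ge0 : 0 <= C / b 0%N by rewrite (le_trans _ (bound 0%N)).
have x_ge0 : 0 <= C / b 0%N / (s - 1) by rewrite divr_ge0 // subr_ge0 ltW.
have := archi_boundP x_ge0; set n := Num.bound _.
rewrite ltr_pdivrMr ?subr_gt0 // => big_n.
have := le_trans (bernoulli_ineq n (ltW s_gt1)) (bound n).
lra.
Qed.

(** With [b n] the squared norm of the [n]-th iterate, symmetry writes [b n.+1] as the inner product
    of iterates [n] and [n.+2], so Cauchy-Schwarz makes [b] log-convex. The growth lemma then bounds
    the norm of [K f] by [q] times that of [f], and a second Cauchy-Schwarz bounds the form. *)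
Lemma quad_form_power_bound (R : archiRealFieldType) (T : finType)
    (O : {set T}) (K : (T -> R) -> T -> R) (f : T -> R) (C q : R) :
  (forall g h, \sum_(x in O) g x * K h x = \sum_(x in O) K g x * h x) ->
  0 < q ->
  (forall n, \sum_(x in O) iter n K f x ^+ 2 <= C * (q ^+ 2) ^+ n) ->
  \sum_(x in O) f x * K f x <= q * \sum_(x in O) f x ^+ 2.
Proof.
move=> K_sym q_gt0 b_le; pose b n := \sum_(x in O) iter n K f x ^+ 2.
have b_ge0 n : 0 <= b n by apply: sumr_ge0 => x _; apply: sqr_ge0.
have b_cvx n : b n.+1 ^+ 2 <= b n * b n.+2.
  have -> : b n.+1 = \sum_(x in O) iter n K f x * iter n.+2 K f x.
    by rewrite (K_sym (iter n K f)); apply: eq_bigr => x _; rewrite expr2.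
  exact: sum_Cauchy_Schwarz.
have b1_le : b 1%N <= q ^+ 2 * b 0%N.
  by apply: log_convex_growth b_le; rewrite // exprn_gt0.
have a_sq : (\sum_(x in O) f x * K f x) ^+ 2 <= (q * b 0%N) ^+ 2.
  rewrite (le_trans (sum_Cauchy_Schwarz _ _ _)) // exprMn.
  rewrite [b 0%N ^+ 2]expr2 mulrCA.
  exact: ler_wpM2l (b_ge0 0%N) _ _ b1_le.
have qb_ge0 : 0 <= q * b 0%N by rewrite mulr_ge0 // ltW.
apply: le_trans (ler_norm _) _.
change (`|\sum_(x in O) f x * K f x| <= q * b 0%N).
by rewrite -(@ler_pXn2r _ 2) ?nnegrE ?real_normK ?num_real.
Qed.

(** * Exchanges of two points *)

Section Swap.

Variables (V : finType).
Implicit Types (x y : V) (A B : {set V}).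

(** Being the image under a transposition, it is a total involution that preserves size and
    disjointness; it replaces [x] by [y] when [x \in A] and [y \notin A]. *)
Definition swap x y A : {set V} := tperm x y @: A.

Lemma in_swap x y A z : (z \in swap x y A) = (tperm x y z \in A).
Proof. by rewrite -{1}[z](tpermK x y) mem_imset //; apply: perm_inj. Qed.

Lemma swapK x y : involutive (swap x y).
Proof. by move=> A; apply/setP => z; rewrite !in_swap tpermK. Qed.

Lemma card_swap x y A : #|swap x y A| = #|A|.
Proof. by rewrite card_imset //; apply: perm_inj. Qed.

Lemma disjoint_swap x y A B :
  [disjoint swap x y A & swap x y B] = [disjoint A & B].
Proof. by rewrite imset_disjoint //; apply: perm_inj. Qed.

Lemma swap_id x y A : x \notin A -> y \notin A -> swap x y A = A.
Proof.
move=> xA yA; apply/setP => z; rewrite in_swap.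
by case: tpermP => // ->; rewrite (negPf xA) (negPf yA).
Qed.

Lemma swap_subset x y A (S : {set V}) :
  x \in S -> y \in S -> A \subset S -> swap x y A \subset S.
Proof.
move=> xS yS AS; apply/subsetP => z; rewrite in_swap.
by case: tpermP => [->|->|_ _ /(subsetP AS)].
Qed.

(** Walk from [A] to [B]: each exchange trades a point of [A :\: B] for one of [B :\: A] and so
    shrinks [A :\: B] by one. The walk never leaves [S], which is later the whole space or the
    complement of a fixed set. *)
Lemma swap_lipschitz (R : realDomainType) (f : {set V} -> R) (l : nat)
    (S : {set V}) (c : R) :
  (forall A x y, #|A| = l -> A \subset S -> x \in A -> y \in S -> y \notin A ->
    `|f A - f (swap x y A)| <= c) ->
  forall A B, #|A| = l -> #|B| = l -> A \subset S -> B \subset S ->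
  `|f A - f B| <= #|A :\: B|%:R * c.
Proof.
move=> f_lip A B + cB + BS.
have [n] := ubnP #|A :\: B|; elim: n A => // n IHn A ltAn cA AS.
have [AB0|/set0Pn[x xAB]] := eqVneq (A :\: B) set0.
  have -> : A = B.
    by apply/eqP; rewrite eqEcard cA cB leqnn -setD_eq0 AB0 eqxx.
  by rewrite subrr normr0 setDv cards0 mul0r.
have [y yBA] : exists y, y \in B :\: A.
  apply/set0Pn; rewrite -card_gt0.
  have cE : #|B :\: A| = #|A :\: B| by rewrite !cardsD cA cB setIC.
  by rewrite cE card_gt0; apply/set0Pn; exists x.
move: (xAB) (yBA); rewrite !inE => /andP[xB xA] /andP[yA yB].
have yS := subsetP BS y yB; have xS := subsetP AS x xA.
have DE : swap x y A :\: B = (A :\: B) :\ x.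
  apply/setP => z; rewrite !inE in_swap.
  case: tpermP => [->|->|/eqP/negPf-> _] //; first by rewrite (negPf yA) eqxx andbF.
  by rewrite yB andbF.
have cD : #|A :\: B| = #|swap x y A :\: B|.+1.
  by rewrite DE [LHS](cardsD1 x) xAB.
rewrite -(subrK (f (swap x y A)) (f A)) -addrA (le_trans (ler_normD _ _)) //.
rewrite cD -add1n natrD mulrDl mul1r lerD ?f_lip //.
apply: IHn; rewrite ?card_swap ?swap_subset //.
by move: ltAn; rewrite cD.
Qed.

(** This is the Lipschitz bound with constant 0, after a cast to [rat] that makes differences
    available. *)
Lemma swap_invariant_const (f : {set V} -> nat) (l : nat) (S : {set V}) :
  (forall A x y, #|A| = l -> A \subset S -> x \in S -> y \in S ->
    f (swap x y A) = f A) ->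
  forall A B, #|A| = l -> #|B| = l -> A \subset S -> B \subset S -> f A = f B.
Proof.
move=> f_inv A B cA cB AS BS.
apply/eqP; rewrite -(eqr_nat rat) -subr_eq0 -normr_le0 -(mulr0 #|A :\: B|%:R).
apply: (swap_lipschitz (f := fun A => (f A)%:R)) cA cB AS BS.
move=> A' x y cA' A'S xA' yS _.
by rewrite f_inv ?subrr ?normr0 // (subsetP A'S).
Qed.

Lemma sum_swap (R : nmodType) (P : pred {set V}) (F : {set V} -> R) x y :
  \sum_(B | P B) F B = \sum_(B | P (swap x y B)) F (swap x y B).
Proof. by rewrite (reindex_inj (inv_inj (swapK x y))). Qed.

End Swap.

(** * The Kneser operator and its spectral bound *)

Lemma cardsC_sub (V : finType) (A : {set V}) : #|~: A| = (#|V| - #|A|)%N.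
Proof. by rewrite -(cardsC A) addKn. Qed.

Section Kneser.

Variables (V : finType) (l : nat).
Implicit Types (A B : {set V}).

(** Over ['I_m] this is convertible to [lsubsets m l]; a general [V] keeps ordinals out of the
    spectral part. *)
Definition lsets : {set {set V}} := [set A : {set V} | #|A| == l].

Definition disj_lsets A : {set {set V}} := [set B in lsets | [disjoint A & B]].

(** The adjacency operator of the Kneser graph. *)
Definition kneser (R : nmodType) (f : {set V} -> R) A : R :=
  \sum_(B in disj_lsets A) f B.

Lemma card_lsets : #|lsets| = 'C(#|V|, l).
Proof. exact: card_draws. Qed.

Lemma card_disj_lsets A : #|A| = l -> #|disj_lsets A| = 'C(#|V| - l, l).
Proof.
move=> cA; rewrite -cA -cardsC_sub -cards_draws cA; apply: eq_card => B.
by rewrite !inE andbC disjoint_sym disjoints_subset.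
Qed.

(** Deleting [y] maps these sets injectively to the [l.-1]-subsets of [~: A :\ y]. *)
Lemma card_disj_lsets_mem A y : (0 < l)%N -> #|A| = l -> y \notin A ->
  (#|[set B in disj_lsets A | y \in B]| <= 'C(#|V| - l.+1, l.-1))%N.
Proof.
move=> l_gt0 cA yA.
have -> : (#|V| - l.+1)%N = #|~: A :\ y|.
  by rewrite subnS -cA -cardsC_sub (cardsD1 y) inE yA.
rewrite -cards_draws.
rewrite -(card_in_imset (f := fun B => B :\ y)
                        (D := [set B in disj_lsets A | y \in B])).
  apply/subset_leq_card/subsetP => _ /imsetP[B + ->].
  rewrite !inE -andbA => /and3P[/eqP cB AB yB].
  rewrite setSD -?disjoints_subset 1?disjoint_sym //=.
  by rewrite -cB (cardsD1 y B) yB.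
move=> B C; rewrite !inE => /andP[_ yB] /andP[_ yC] eqBC.
by rewrite -(setD1K yB) -(setD1K yC) eqBC.
Qed.

Lemma disj_lsetsC A B :
  (A \in lsets) && (B \in disj_lsets A) = (B \in lsets) && (A \in disj_lsets B).
Proof. by rewrite !inE disjoint_sym; do 2![case: (_ == _)]. Qed.

Lemma kneser_swap (R : nmodType) (f : {set V} -> R) x y A :
  kneser f (swap x y A) = \sum_(B in disj_lsets A) f (swap x y B).
Proof.
rewrite /kneser (sum_swap _ _ x y); apply: eq_bigl => B.
by rewrite !inE card_swap disjoint_swap.
Qed.

Lemma kneser_sym (R : pzRingType) (g h : {set V} -> R) :
  \sum_(A in lsets) g A * kneser h A = \sum_(A in lsets) kneser g A * h A.
Proof.
under eq_bigr => A _ do rewrite mulr_sumr.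
under [RHS]eq_bigr => A _ do rewrite mulr_suml.
rewrite (exchange_big_dep [pred B | B \in lsets]) => [|A B _]; last first.
  by rewrite !inE => /andP[].
by apply: eq_bigr => B /= cB; apply: eq_bigl => A; rewrite disj_lsetsC cB.
Qed.

(** Symmetry is applied against the constant 1, which the operator multiplies by the degree of the
    graph. In particular sum-zero functions stay sum-zero. *)
Lemma kneser_sum (R : pzRingType) (f : {set V} -> R) :
  \sum_(A in lsets) kneser f A = 'C(#|V| - l, l)%:R * \sum_(A in lsets) f A.
Proof.
under eq_bigr => A _ do rewrite -[kneser f A]mul1r.
rewrite (kneser_sym (fun=> 1)) mulr_sumr; apply: eq_bigr => A.
rewrite inE => /eqP cA.
by rewrite /kneser sumr_const card_disj_lsets.
Qed.

(** After reindexing by the swap, the difference is a sum of [f B - f (swap x y B)] over [B]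
    disjoint from [A]. Such [B] miss [x], so the swap fixes those that also miss [y]; only the few
    [B] containing [y] remain. *)
Lemma kneser_lipschitz (R : realDomainType) (f : {set V} -> R) (c : R) :
  (0 < l)%N -> 0 <= c ->
  (forall A x y, #|A| = l -> x \in A -> y \notin A ->
    `|f A - f (swap x y A)| <= c) ->
  forall A x y, #|A| = l -> x \in A -> y \notin A ->
    `|kneser f A - kneser f (swap x y A)| <= 'C(#|V| - l.+1, l.-1)%:R * c.
Proof.
move=> l_gt0 c_ge0 f_lip A x y cA xA yA.
rewrite kneser_swap -sumrB (bigID (fun B : {set V} => y \in B)) /=.
rewrite [X in _ + X]big1 ?addr0 => [|B /andP[]]; last first.
  rewrite !inE => /andP[_ dAB] yB.
  by rewrite swap_id ?subrr // (disjointFr dAB).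
apply: le_trans (ler_norm_sum _ _ _) _.
apply: (@le_trans _ _ (\sum_(B in disj_lsets A | y \in B) c)).
  apply: ler_sum => B /andP[]; rewrite !inE => /andP[/eqP cB dAB] yB.
  (* Here [y] is inside [B] and [x] outside, so the hypothesis is used with their roles reversed. *)
  have -> : swap x y B = swap y x B by rewrite /swap tpermC.
  by apply: f_lip; rewrite // (disjointFr dAB).
have -> : \sum_(B in disj_lsets A | y \in B) c =
          \sum_(B in [set B in disj_lsets A | y \in B]) c.
  by apply: eq_bigl => B; rewrite !inE.
rewrite sumr_const -[c *+ _]mulr_natl; apply: ler_wpM2r; rewrite // ler_nat.
exact: card_disj_lsets_mem.
Qed.

(** The iterates stay sum-zero, and their Lipschitz constants for exchanges grow at most like
    [k ^+ n]. A function of mean zero is bounded by its oscillation, and any two [l]-sets are at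
    most [l] exchanges apart. *)
Lemma kneser_iter_bound (R : realFieldType) (f : {set V} -> R) :
  (0 < l)%N -> \sum_(A in lsets) f A = 0 ->
  exists C : R, forall n,
    \sum_(A in lsets) iter n (@kneser R) f A ^+ 2
    <= C * ('C(#|V| - l.+1, l.-1)%:R ^+ 2) ^+ n.
Proof.
move=> l_gt0 f_sum0; set k := 'C(_, _)%:R; pose g n := iter n (@kneser R) f.
have g_sum0 n : \sum_(A in lsets) g n A = 0.
  by elim: n => [|n IHn] //=; rewrite kneser_sum IHn mulr0.
(* A crude Lipschitz constant for [f] itself: each of the two values is at most the whole sum. *)
pose c := 2 * \sum_A `|f A|.
have f_le A : `|f A| <= \sum_A `|f A|.
  by rewrite (bigD1 A) //= lerDl sumr_ge0.
have c_ge0 : 0 <= c by rewrite mulr_ge0 ?sumr_ge0.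
have k_ge0 n : 0 <= k ^+ n * c by rewrite mulr_ge0 // exprn_ge0.
have g_lip n : forall A x y, #|A| = l -> x \in A -> y \notin A ->
    `|g n A - g n (swap x y A)| <= k ^+ n * c.
  elim: n => [|n IHn] A x y cA xA yA.
    rewrite mul1r /c mulr_natl mulr2n (le_trans (ler_normB _ _)) //.
    exact: lerD (f_le _) (f_le _).
  by rewrite exprS -mulrA; apply: kneser_lipschitz.
have g_le n A : A \in lsets -> `|g n A| <= l%:R * (k ^+ n * c).
  move=> lA; have cA : #|A| = l by move: lA; rewrite inE => /eqP.
  have N_gt0 : 0 < #|lsets|%:R :> R by rewrite ltr0n (cardD1 A) lA.
  (* As the mean of [g n] is zero, a value equals the average of its differences to all values. *)
  have -> : g n A = #|lsets|%:R^-1 * \sum_(B in lsets) (g n A - g n B).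
    rewrite sumrB g_sum0 subr0 sumr_const -[g n A *+ _]mulr_natl mulKf //.
    exact: lt0r_neq0.
  rewrite normrM ger0_norm ?invr_ge0 ?ler0n // ler_pdivrMl //.
  rewrite (le_trans (ler_norm_sum _ _ _)) // [leRHS]mulr_natl -[leRHS]sumr_const.
  apply: ler_sum => B.
  rewrite inE => /eqP cB.
  apply: (@le_trans _ _ (#|A :\: B|%:R * (k ^+ n * c))).
    apply: (swap_lipschitz (l := l) (S := [set: V])); rewrite ?subsetT //.
    by move=> A' x y cA' _ xA' _; apply: g_lip.
  by apply: ler_wpM2r; rewrite // ler_nat -cA subset_leq_card // subsetDl.
(* The number of [l]-sets times the square of the pointwise bound, with the power of [k] taken
   out. *)
exists (#|lsets|%:R * (l%:R * c) ^+ 2) => n.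
have -> : #|lsets|%:R * (l%:R * c) ^+ 2 * (k ^+ 2) ^+ n =
          \sum_(A in lsets) (l%:R * (k ^+ n * c)) ^+ 2.
  by rewrite sumr_const -[RHS]mulr_natl -exprM mulnC exprM; ring.
apply: ler_sum => A lA; rewrite -(real_normK (num_real _)).
apply: lerXn2r; last exact: g_le; rewrite nnegrE ?normr_ge0 //.
by apply: mulr_ge0.
Qed.

Lemma kneser_spectral_archi (R : archiRealFieldType) (f : {set V} -> R) :
  (0 < l)%N -> (l.*2 <= #|V|)%N -> \sum_(A in lsets) f A = 0 ->
  \sum_(A in lsets) f A * kneser f A
  <= 'C(#|V| - l.+1, l.-1)%:R * \sum_(A in lsets) f A ^+ 2.
Proof.
move=> l_gt0 le_lV f_sum0.
have [C C_le] := kneser_iter_bound l_gt0 f_sum0.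
apply: (quad_form_power_bound (C := C)) => //; first exact: kneser_sym.
(* Two disjoint [l]-sets fit into [V], which makes the binomial constant positive. *)
by rewrite ltr0n bin_gt0; lia.
Qed.

End Kneser.

Lemma sum_indicator (R : pzSemiRingType) (T : finType) (S G : {set T}) :
  G \subset S -> \sum_(A in S) (A \in G)%:R = #|G|%:R :> R.
Proof.
move=> GS; rewrite -natr_sum -sum1_card big_mkcond [in RHS]big_mkcond /=.
congr _%:R; apply: eq_bigr => A _; have := subsetP GS A.
by case: (A \in G) => [->|_] //; case: (A \in S).
Qed.

(* The power argument needs an archimedean field, but the inequality is between
   rational numbers: clearing denominators transfers it to any R. *)
Lemma kneser_spectral (R : realFieldType) (V : finType) (l : nat)
    (G : {set {set V}}) :
  let a : R := #|G|%:R / 'C(#|V|, l)%:R in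
  let h (A : {set V}) : R := (A \in G)%:R - a in
  (0 < l)%N -> (l.*2 <= #|V|)%N -> G \subset lsets V l ->
  \sum_(A in lsets V l) \sum_(B in disj_lsets l A) h A * h B
  <= 'C(#|V| - l.+1, l.-1)%:R * \sum_(A in lsets V l) h A ^+ 2.
Proof.
move=> a h l_gt0 le_lV GL; pose N := 'C(#|V|, l).
have N_gt0 : (0 < N)%N by rewrite bin_gt0; lia.
have NR_gt0 : 0 < N%:R :> R by rewrite ltr0n.
(* [F] is [N] times [h]: integer-valued and still sum-zero. *)
pose F (A : {set V}) : int := N%:R * (A \in G)%:R - #|G|%:R.
have hE A : h A = (F A)%:~R / N%:R.
  rewrite /h /a -/N /F rmorphB rmorphM /= !rmorph_nat.
  by field; apply: lt0r_neq0.
have F_sum0 : \sum_(A in lsets V l) F A = 0.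
  rewrite sumrB -mulr_sumr sum_indicator // sumr_const card_lsets -/N.
  by rewrite -[#|G|%:R *+ N]mulr_natl subrr.
have castK (S : realFieldType) : \sum_(A in lsets V l) (F A)%:~R *
      kneser l (fun A => (F A)%:~R) A =
    (\sum_(A in lsets V l) F A * kneser l F A)%:~R :> S.
  by rewrite rmorph_sum; apply: eq_bigr => A _; rewrite rmorphM rmorph_sum.
have castS (S : realFieldType) (k : nat) :
    k%:R * \sum_(A in lsets V l) (F A)%:~R ^+ 2 =
    (k%:R * \sum_(A in lsets V l) F A ^+ 2)%:~R :> S.
  rewrite rmorphM rmorph_sum /= rmorph_nat; congr (_ * _).
  by apply: eq_bigr => A _; rewrite rmorphXn.
have : \sum_(A in lsets V l) F A * kneser l F A
   <= 'C(#|V| - l.+1, l.-1)%:R * \sum_(A in lsets V l) F A ^+ 2.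
  have := @kneser_spectral_archi V l rat (fun A => (F A)%:~R) l_gt0 le_lV.
  rewrite castK castS ler_int; apply.
  by rewrite -rmorph_sum F_sum0.
have N2_gt0 : 0 < N%:R^-1 ^+ 2 :> R by rewrite exprn_gt0 // invr_gt0.
rewrite -(ler_int R) -castK -castS -(ler_pM2r N2_gt0).
rewrite -mulrA !mulr_suml; congr (_ <= _); last first.
  by congr (_ * _); apply: eq_bigr => A _; rewrite hE exprMn.
apply: eq_bigr => A _; rewrite mulr_sumr mulr_suml.
by apply: eq_bigr => B _; rewrite !hE; ring.
Qed.

(** * Chebyshev's inequality *)

Lemma unifPr_chebyshev (R : realFieldType) (T : finType) (O : {set T})
    (X : T -> R) (d : R) :
  0 < d ->
  unifPr R O (fun w => d <= `|X w|) <= unifE O (fun w => X w ^+ 2) / d ^+ 2.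
Proof.
move=> d_gt0; rewrite /unifPr /unifE mulrAC ler_wpM2r ?invr_ge0 ?ler0n //.
rewrite ler_pdivlMr ?exprn_gt0 // -sum1_card natr_sum mulr_suml.
rewrite [leRHS](bigID (fun w => d <= `|X w|)) /= -[leLHS]addr0 lerD //.
  rewrite (eq_bigl (fun w => (w \in O) && (d <= `|X w|))); last first.
    by move=> w; rewrite inE.
  apply: ler_sum => w /andP[_ dX]; rewrite mul1r -(real_normK (num_real (X w))).
  by apply: lerXn2r; rewrite ?nnegrE // ltW.
by apply: sumr_ge0 => w _; apply: sqr_ge0.
Qed.

(** * Marginals of a uniform disjoint tuple *)

Section DisjointTuples.

Variables (m l t : nat).

Local Notation V := 'I_m.
Local Notation DT := (disjoint_tuples m l t).
Implicit Types (A B : {set V}) (T : t.-tuple {set V}) (i j : 'I_t).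

Lemma disjoint_tuplesP T :
  reflect ((forall i, #|tnth T i| = l) /\
           (forall i j, i != j -> [disjoint tnth T i & tnth T j]))
          (T \in DT).
Proof.
rewrite inE; apply: (iffP andP) => -[cT dT]; split.
- by move=> i; move/forallP: cT => /(_ i); rewrite inE => /eqP.
- by move=> i j; move/forallP: dT => /(_ i)/forallP/(_ j)/implyP.
- by apply/forallP => i; rewrite inE cT.
- by apply/forallP => i; apply/forallP => j; apply/implyP; apply: dT.
Qed.

(** Transpositions of the ground set act on the sample space; this symmetry makes the marginals
    uniform. *)
Definition swap_tuple (x y : V) T := map_tuple (swap x y) T.

Lemma swap_tupleK x y : involutive (swap_tuple x y).
Proof. by move=> T; apply: eq_from_tnth => i; rewrite !tnth_map swapK. Qed.

Lemma mem_swap_tuple x y T : (swap_tuple x y T \in DT) = (T \in DT).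
Proof.
have imp T' : T' \in DT -> swap_tuple x y T' \in DT.
  move=> /disjoint_tuplesP[cT dT]; apply/disjoint_tuplesP.
  split=> [i|i j neq_ij]; rewrite !tnth_map ?card_swap //.
  by rewrite disjoint_swap dT.
by apply/idP/idP => [/imp|/imp//]; rewrite swap_tupleK.
Qed.

(** The unnormalised law of component [i]; [count2] below is the joint law of components [i] and
    [j]. *)
Definition count1 i A := #|[set T in DT | tnth T i == A]|.

Definition count2 i j A B :=
  #|[set T in DT | (tnth T i == A) && (tnth T j == B)]|.

Lemma count2_swap i j x y A B :
  count2 i j (swap x y A) (swap x y B) = count2 i j A B.
Proof.
rewrite /count2 -!sum1_card (reindex_inj (inv_inj (swap_tupleK x y))) /=.
apply: eq_bigl => T; rewrite [LHS]in_set [RHS]in_set mem_swap_tuple !tnth_map.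
by rewrite !(inj_eq (inv_inj (swapK x y))).
Qed.

Lemma count1_swap i x y A : count1 i (swap x y A) = count1 i A.
Proof.
rewrite /count1 -!sum1_card (reindex_inj (inv_inj (swap_tupleK x y))) /=.
apply: eq_bigl => T; rewrite [LHS]in_set [RHS]in_set mem_swap_tuple !tnth_map.
by rewrite !(inj_eq (inv_inj (swapK x y))).
Qed.

Lemma sum_by_tnth (R : pzRingType) i (h : {set V} -> R) :
  \sum_(T in DT) h (tnth T i) = \sum_(A in lsets V l) (count1 i A)%:R * h A.
Proof.
rewrite (partition_big (fun T => tnth T i) (mem (lsets V l))) /=; last first.
  by move=> T /disjoint_tuplesP[cT _]; rewrite inE cT.
apply: eq_bigr => A _; rewrite mulr_natl /count1 -sumr_const.
apply: eq_big => [T|T /andP[_ /eqP->]] //; by rewrite [RHS]in_set.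
Qed.

Lemma sum_by_tnth2 (R : pzRingType) i j (H : {set V} -> {set V} -> R) : i != j ->
  \sum_(T in DT) H (tnth T i) (tnth T j) =
  \sum_(A in lsets V l) \sum_(B in disj_lsets l A) (count2 i j A B)%:R * H A B.
Proof.
move=> neq_ij.
rewrite (partition_big (fun T => tnth T i) (mem (lsets V l))) /=; last first.
  by move=> T /disjoint_tuplesP[cT _]; rewrite inE cT.
apply: eq_bigr => A _.
rewrite (partition_big (fun T => tnth T j) (mem (disj_lsets l A))) /=; last first.
  by move=> T /andP[/disjoint_tuplesP[cT dT] /eqP<-]; rewrite !inE cT dT ?eqxx.
apply: eq_bigr => B _; rewrite mulr_natl /count2 -sumr_const.
apply: eq_big => [T|T /andP[/andP[_ /eqP->] /eqP->]] //.
by rewrite [RHS]in_set andbA.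
Qed.

(** [count1 i] is invariant under exchanges, hence constant on [l]-sets, so component [i] is
    uniform. Cross-multiplication avoids division. *)
Lemma sum_tnth (R : comPzRingType) i (h : {set V} -> R) :
  'C(m, l)%:R * \sum_(T in DT) h (tnth T i) =
  #|DT|%:R * \sum_(A in lsets V l) h A.
Proof.
have cE A : A \in lsets V l -> ('C(m, l) * count1 i A)%N = #|DT|.
  rewrite inE => /eqP cA.
  have -> : #|DT| = (\sum_(B in lsets V l) count1 i B)%N.
    rewrite -sum1_card.
    rewrite (partition_big (fun T => tnth T i) (mem (lsets V l))) /=; last first.
      by move=> T /disjoint_tuplesP[cT _]; rewrite inE cT.
    apply: eq_bigr => B _; rewrite /count1 -sum1_card; apply: eq_bigl => T.
    by rewrite [RHS]in_set.
  rewrite (eq_bigr (fun=> count1 i A)); last first.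
    move=> B; rewrite inE => /eqP cB.
    apply: (swap_invariant_const (l := l) (S := [set: V])); rewrite ?subsetT //.
    by move=> *; apply: count1_swap.
  by rewrite sum_nat_const card_lsets card_ord.
rewrite sum_by_tnth !mulr_sumr; apply: eq_bigr => A /cE <-.
by rewrite natrM mulrA.
Qed.

(** Given that component [i] is [A], component [j] is uniform on the [l]-subsets of [~: A], because
    exchanges of points outside [A] fix [A]. Uniformity of component [i] does the rest. *)
Lemma sum_tnth2 (R : comPzRingType) i j (H : {set V} -> {set V} -> R) : i != j ->
  'C(m, l)%:R * 'C(m - l, l)%:R * \sum_(T in DT) H (tnth T i) (tnth T j) =
  #|DT|%:R * \sum_(A in lsets V l) \sum_(B in disj_lsets l A) H A B.
Proof.
move=> neq_ij.
have cE A B : A \in lsets V l -> B \in disj_lsets l A ->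
    ('C(m - l, l) * count2 i j A B)%N = count1 i A.
  rewrite !inE => /eqP cA /andP[/eqP cB dAB].
  have -> : count1 i A = (\sum_(C in disj_lsets l A) count2 i j A C)%N.
    rewrite /count1 -sum1_card.
    rewrite (partition_big (fun T => tnth T j) (mem (disj_lsets l A))) /=; last first.
      move=> T; rewrite [_ \in _]in_set => /andP[/disjoint_tuplesP[cT dT] /eqP<-].
      by rewrite !inE cT dT ?eqxx.
    apply: eq_bigr => C _; rewrite /count2 -sum1_card; apply: eq_bigl => T.
    by rewrite [RHS]in_set [X in X && _]in_set andbA.
  rewrite (eq_bigr (fun=> count2 i j A B)); last first.
    move=> C; rewrite !inE => /andP[/eqP cC dAC].
    apply: (swap_invariant_const (f := count2 i j A) (l := l) (S := ~: A)) => //.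
    - move=> B' x y _ _; rewrite !inE => xA yA.
      by rewrite -[A in LHS](swap_id xA yA) count2_swap.
    - by rewrite -disjoints_subset disjoint_sym.
    - by rewrite -disjoints_subset disjoint_sym.
  by rewrite sum_nat_const card_disj_lsets // card_ord.
transitivity ('C(m, l)%:R * \sum_(T in DT)
    \sum_(B in disj_lsets l (tnth T i)) H (tnth T i) B).
  rewrite -mulrA (sum_by_tnth2 _ neq_ij); congr (_ * _).
  rewrite (sum_by_tnth i (fun A => \sum_(B in disj_lsets l A) H A B)) mulr_sumr.
  apply: eq_bigr => A lA; rewrite !mulr_sumr; apply: eq_bigr => B dB.
  by rewrite mulrA -natrM cE.
exact: (sum_tnth i (fun A => \sum_(B in disj_lsets l A) H A B)).
Qed.

Lemma disjoint_tuples_neq0 : (0 < l)%N -> (t * l <= m)%N -> DT != set0.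
Proof.
move=> l_gt0 le_tl_m; apply/set0Pn.
(* The consecutive blocks of length [l]; block [i] consists of the [i * l + k] with [k < l]. *)
pose T := [tuple [set k : V | (k %/ l)%N == i] | i < t].
exists T; apply/disjoint_tuplesP; split=> [i|i j neq_ij]; rewrite !tnth_mktuple.
  have lt_m (k : 'I_l) : (i * l + k < m)%N.
    have := ltn_ord k; have := ltn_ord i; nia.
  pose f k := Ordinal (lt_m k).
  rewrite -[RHS]card_ord -(card_imset _ (_ : injective f)); last first.
    by move=> k k' /(congr1 val) /= /addnI /val_inj.
  apply: eq_card => k; rewrite inE; apply/eqP/imsetP => [kl|[k' _ ->]] /=.
    exists (Ordinal (ltn_pmod k l_gt0)) => //; apply: val_inj => /=.
    by rewrite -kl -divn_eq.
  by rewrite divnMDl // divn_small ?addn0.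
apply/pred0P => k; rewrite !inE; apply/negP => /andP[/eqP ki /eqP kj].
by case/eqP: neq_ij; apply: val_inj; rewrite /= -ki.
Qed.

End DisjointTuples.

(** * Mean and variance of [eta] *)

Lemma etaE (m l t : nat) (G : {set {set 'I_m}}) (T : t.-tuple {set 'I_m}) :
  (0 < l)%N -> T \in disjoint_tuples m l t ->
  eta G T = (\sum_(i < t) (tnth T i \in G))%N.
Proof.
move=> l_gt0 /disjoint_tuplesP[cT dT].
have tnth_inj : injective (tnth T).
  (* Equal components at distinct indices would be disjoint from themselves, hence empty, against
     [0 < l]. *)
  move=> i j eq_ij; apply/eqP; apply: contraT => /dT.
  by rewrite eq_ij -setI_eq0 setIid -cards_eq0 cT => /eqP l0; rewrite l0 in l_gt0.
have -> : eta G T = #|[set tnth T i | i in [set i | tnth T i \in G]]|.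
  apply: eq_card => A; rewrite !inE; apply/andP/imsetP => [[AG /tnthP[i Ai]]|[i]].
    by exists i; rewrite ?inE -?Ai.
  by rewrite inE => iG ->; rewrite mem_tnth.
rewrite card_imset // -sum1_card big_mkcond; apply: eq_bigr => i _.
by rewrite inE; case: (_ \in G).
Qed.

(** Absorption, [l * 'C(m - l, l) = (m - l) * 'C(m - l.+1, l.-1)], reduces this to
    [t.-1 * l <= m - l]. *)
Lemma bin_sub_bound (m l t : nat) : (0 < l)%N -> (t * l <= m)%N ->
  (t.-1 * 'C(m - l.+1, l.-1) <= 'C(m - l, l))%N.
Proof.
case: l => // l _ le_m; have := mul_bin_diag (m - l.+1) l.
rewrite -subnS /= => E; rewrite -(leq_pmul2l (ltn0Sn l)) -E.
rewrite mulnCA mulnA leq_mul2r.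
by apply/orP; right; nia.
Qed.

Lemma sum_centered_sqr (R : realFieldType) (T : finType) (S G : {set T}) :
  G \subset S -> (0 < #|S|)%N ->
  let a : R := #|G|%:R / #|S|%:R in
  \sum_(A in S) ((A \in G)%:R - a) ^+ 2 = #|S|%:R * (a * (1 - a)).
Proof.
move=> GS S_gt0 a.
have S_neq0 : #|S|%:R != 0 :> R by rewrite pnatr_eq0 -lt0n.
(* An indicator equals its square, so the summand is affine in it. *)
transitivity (\sum_(A in S) ((1 - 2 * a) * (A \in G)%:R + a ^+ 2)).
  by apply: eq_bigr => A _; case: (A \in G) => /=; ring.
rewrite big_split /= -mulr_sumr sum_indicator // sumr_const -[a ^+ 2 *+ _]mulr_natl.
by rewrite /a; field.
Qed.

Theorem lemma10 (R : realFieldType) (m l t : nat) (G : {set {set 'I_m}})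
    (hm : (0 < m)%N) (hl : (0 < l)%N) (ht : (0 < t)%N)
    (hmtl : (t * l <= m)%N) (hG : G \subset lsubsets m l) :
  let alpha : R := density R l G in
  unifE (disjoint_tuples m l t) (fun B => (eta G B)%:R) = alpha * t%:R /\
  forall beta : R, 0 < beta ->
    unifPr R (disjoint_tuples m l t)
      (fun B => beta * t%:R <= `|(eta G B)%:R - alpha * t%:R|)
    <= 2 * alpha * (1 - alpha) / (beta ^+ 2 * t%:R).
Proof.
move=> alpha; set DT := disjoint_tuples m l t.
have DT_gt0 : 0 < #|DT|%:R :> R by rewrite ltr0n card_gt0 disjoint_tuples_neq0.
have N_gt0 : 0 < 'C(m, l)%:R :> R by rewrite ltr0n bin_gt0; nia.
have t_gt0 : 0 < t%:R :> R by rewrite ltr0n.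
have cardL : #|lsets 'I_m l| = 'C(m, l) by rewrite card_lsets card_ord.
split.
  (* Linearity of expectation: each of the [t] indicators has mean [alpha]. *)
  rewrite /unifE (eq_bigr (fun T => \sum_(i < t) (tnth T i \in G)%:R)); last first.
    by move=> T dT; rewrite (etaE _ hl dT) natr_sum.
  rewrite exchange_big /= (eq_bigr (fun=> #|DT|%:R * alpha)); last first.
    move=> i _; apply: (mulfI (lt0r_neq0 N_gt0)).
    rewrite (sum_tnth l i (fun A => (A \in G)%:R)) sum_indicator // /alpha /density.
    by field; apply: lt0r_neq0.
  rewrite sumr_const card_ord -[_ *+ t]mulr_natl; field; exact: lt0r_neq0.
move=> beta beta_gt0; pose h (A : {set 'I_m}) : R := (A \in G)%:R - alpha.
pose v := alpha * (1 - alpha).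
have sum_h2 : \sum_(A in lsets 'I_m l) h A ^+ 2 = 'C(m, l)%:R * v.
  by rewrite /h /v /alpha /density -cardL sum_centered_sqr // cardL -(ltr0n R).
have v_ge0 : 0 <= v.
  rewrite -(pmulr_rge0 _ N_gt0) -sum_h2.
  by apply: sumr_ge0 => A _; apply: sqr_ge0.
(* [#|DT|] times the covariance of the indicators that components [i] and [j] lie in [G]. *)
pose S i j := \sum_(T in DT) h (tnth T i) * h (tnth T j).
have S_diag i : S i i = #|DT|%:R * v.
  apply: (mulfI (lt0r_neq0 N_gt0)).
  rewrite /S (sum_tnth l i (fun A => h A * h A)) mulrCA -sum_h2.
  by congr (_ * _); apply: eq_bigr => A _; rewrite expr2.
(* The spectral bound combined with [bin_sub_bound]: [t.-1] times an off-diagonal covariance is at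
   most the variance of one indicator. *)
have S_off i j : i != j -> t.-1%:R * S i j <= #|DT|%:R * v.
  move=> neq_ij; have t_gt1 : (1 < t)%N.
    move: neq_ij; rewrite -val_eqE /=; have := ltn_ord i; have := ltn_ord j; lia.
  have D_gt0 : 0 < 'C(m - l, l)%:R :> R by rewrite ltr0n bin_gt0; nia.
  rewrite -(ler_pM2l (mulr_gt0 N_gt0 D_gt0)) mulrCA.
  rewrite /S (sum_tnth2 l (fun A B => h A * h B) neq_ij).
  have le2l : (l.*2 <= m)%N by nia.
  have := @kneser_spectral R 'I_m l G hl.
  rewrite !card_ord => /(_ le2l hG); rewrite -/(density R l G) -/alpha -/h sum_h2.
  set Q := \sum_(A in _) _ => spec.
  have : t.-1%:R * 'C(m - l.+1, l.-1)%:R <= 'C(m - l, l)%:R :> R.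
    by rewrite -natrM ler_nat bin_sub_bound.
  move: spec; set k := 'C(m - l.+1, _)%:R => spec k_le.
  apply: (@le_trans _ _ (#|DT|%:R * (t.-1%:R * (k * ('C(m, l)%:R * v))))).
    by rewrite mulrCA ler_pM2l // ler_wpM2l.
  have -> : 'C(m, l)%:R * 'C(m - l, l)%:R * (#|DT|%:R * v) =
            #|DT|%:R * ('C(m - l, l)%:R * ('C(m, l)%:R * v)) by ring.
  by rewrite ler_pM2l // mulrA ler_wpM2r // mulr_ge0 // ltW.
have sum_S : \sum_(T in DT) ((eta G T)%:R - alpha * t%:R) ^+ 2 =
             \sum_i \sum_j S i j.
  rewrite (eq_bigr (fun T => \sum_i \sum_j h (tnth T i) * h (tnth T j))).
    by rewrite exchange_big; apply: eq_bigr => i _; rewrite exchange_big.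
  move=> T dT; rewrite (etaE _ hl dT) natr_sum.
  have -> : alpha * t%:R = \sum_(i < t) alpha.
    by rewrite sumr_const card_ord mulr_natr.
  rewrite -sumrB expr2 mulr_suml; apply: eq_bigr => i _.
  by rewrite mulr_sumr.
(* The factor 2 arises here: the diagonal entry gives [#|DT|%:R * v], and the [t.-1] others together
   give at most as much. *)
have row_le i : \sum_j S i j <= 2 * (#|DT|%:R * v).
  rewrite (bigD1 i) //= S_diag [leRHS]mulr_natl mulr2n lerD2l.
  (* For [t = 1] there are no other entries, and [t.-1 = 0] could not be cancelled. *)
  have [t1|t_gt1] := leqP t 1.
    rewrite big1 => [|j]; first by rewrite pmulr_rge0.
    rewrite -val_eqE /=; have := ltn_ord i; have := ltn_ord j; lia.
  have t1_gt0 : 0 < t.-1%:R :> R by rewrite ltr0n; lia.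
  rewrite -(ler_pM2l t1_gt0) mulr_sumr.
  apply: (@le_trans _ _ (\sum_(j < t | j != i) #|DT|%:R * v)).
    by apply: ler_sum => j neq_ji; apply: S_off; rewrite eq_sym.
  by rewrite sumr_const cardC1 card_ord [leRHS]mulr_natl.
have var_le :
    unifE DT (fun T => ((eta G T)%:R - alpha * t%:R) ^+ 2) <= 2 * v * t%:R.
  rewrite /unifE sum_S ler_pdivrMr //.
  apply: (@le_trans _ _ (\sum_(i < t) 2 * (#|DT|%:R * v))).
    exact: ler_sum.
  suff -> : \sum_(i < t) 2 * (#|DT|%:R * v) = 2 * v * t%:R * #|DT|%:R by [].
  by rewrite sumr_const card_ord -[LHS]mulr_natl; ring.
apply: le_trans (unifPr_chebyshev _ _ (mulr_gt0 beta_gt0 t_gt0)) _.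
rewrite ler_pdivrMr ?exprn_gt0 ?mulr_gt0 // (le_trans var_le) //.
rewrite le_eqVlt; apply/orP; left; apply/eqP; rewrite /v; field.
by rewrite !lt0r_neq0.
Qed.
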